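(* Let $S$ be a finite nonempty set of examples (the stop set), and let $M_t, M_{t-1}, y : S \to \{+1,-1\}$ be, respectively, the classifications on $S$ of the models learned at iterations $t$ and $t-1$ of active learning, and the true labels. Let $K_t$ be the (sample) Cohen's Kappa agreement between the classifications of $M_t$ and $M_{t-1}$ on $S$. Let $\tilde F_t$ be the F-measure between the classifications of $M_t$ and the truth $y$ on $S$, let $\tilde F_{t-1}$ be the F-measure between the classifications of $M_{t-1}$ and the truth $y$ on $S$, and let $\Delta F_t = \tilde F_t - \tilde F_{t-1}$. Let $T$ be a real number with $T > 0$. Then $$K_t > T \;\Longrightarrow\; |\Delta F_t| \le \frac{4(1-T)}{T}.$$
   Context: Given two labelings $L_1, L_2 : S \to \{+1,-1\}$ of a finite set $S$, their contingency table counts are: $a$ = number of examples labeled $+1$ by both; $b$ = number labeled $+1$ by $L_1$ and $-1$ by $L_2$; $c$ = number labeled $-1$ by $L_1$ and $+1$ by $L_2$; $d$ = number labeled $-1$ by both; $n=a+b+c+d=|S|$. Sample Cohen's Kappa between $L_1$ and $L_2$ is $K = \frac{p_o - p_e}{1-p_e}$ with $p_o = \frac{a+d}{n}$ and $p_e = \frac{(a+b)(a+c)}{n^2} + \frac{(c+d)(b+d)}{n^2}$; equivalently $K = \frac{2ad-2bc}{(a+b)(b+d)+(a+c)(c+d)}$. It is defined when the denominator is nonzero. The F-measure (balanced F1, harmonic mean of precision and recall) between $L_1$ and $L_2$ is $F = \frac{2a}{2a+b+c}$; it is symmetric in $L_1, L_2$ and defined when the denominator is nonzero. *)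

(* Defs.v *)
From mathcomp Require Import all_boot all_order all_algebra.
From mathcomp Require Import reals.
Set Implicit Arguments.
Unset Strict Implicit.
Unset Printing Implicit Defensive.
Import Order.TTheory GRing.Theory Num.Theory.
Local Open Scope ring_scope.

(* A labeling of S is a function S -> bool, with true for +1 and false for -1. *)

Definition ct_a (S : finType) (L1 L2 : S -> bool) : nat :=
  #|[set x : S | L1 x && L2 x]|.

Definition ct_b (S : finType) (L1 L2 : S -> bool) : nat :=
  #|[set x : S | L1 x && ~~ L2 x]|.

Definition ct_c (S : finType) (L1 L2 : S -> bool) : nat :=
  #|[set x : S | ~~ L1 x && L2 x]|.

Definition ct_d (S : finType) (L1 L2 : S -> bool) : nat :=
  #|[set x : S | ~~ L1 x && ~~ L2 x]|.

Section Agreement.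
Variables (R : realType) (S : finType) (L1 L2 : S -> bool).

Let a : R := (ct_a L1 L2)%:R.
Let b : R := (ct_b L1 L2)%:R.
Let c : R := (ct_c L1 L2)%:R.
Let d : R := (ct_d L1 L2)%:R.
Let n : R := #|S|%:R.

Definition observed_agreement : R := (a + d) / n.

Definition expected_agreement : R :=
  ((a + b) * (a + c)) / n ^+ 2 + ((c + d) * (b + d)) / n ^+ 2.

(* Where the quotient is undefined, x / 0 = 0 gives cohen_kappa the value 0,
   so cohen_kappa > T with T > 0 entails that it is defined. *)
Definition cohen_kappa : R :=
  (observed_agreement - expected_agreement) / (1 - expected_agreement).

(* Undefined (here 0 by x / 0 = 0) only when neither labeling has a +1.  A
   positive cohen_kappa L1 L2 entails that both L1 and L2 have a +1, and hence
   that the F-measure of L1, or of L2, against any labeling is defined. *)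
Definition f_measure : R := (2 * a) / (2 * a + b + c).

End Agreement.

Arguments observed_agreement R {S} L1 L2.
Arguments expected_agreement R {S} L1 L2.
Arguments cohen_kappa R {S} L1 L2.
Arguments f_measure R {S} L1 L2.

(* Main.v *)
Require Import Defs.
From mathcomp Require Import all_boot all_order all_algebra.
From mathcomp Require Import reals.
From mathcomp Require Import ring lra.
Set Implicit Arguments.
Unset Strict Implicit.
Unset Printing Implicit Defensive.
Import Order.TTheory GRing.Theory Num.Theory.
Local Open Scope ring_scope.

(* Let a, b, c, d be the contingency counts of the two models L1 and L2, let
   n = a + b + c + d, and let e = b + c be the number of disagreements.  Then
   1 - K = e n / (n (2a + e) - 2 (a + b) (a + c)) >= e / (2a + e), so K > T
   gives T e < 2a (1 - T); in particular a > 0.  On the other hand, write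
   F_i = 2 A_i / D_i with A_i = |L_i & y| and D_i = |L_i| + |y|.  Then
   F_1 - F_2 = (2 (A_1 - A_2) + F_2 (D_2 - D_1)) / D_1 with A_1 - A_2 <= b,
   D_2 - D_1 = c - b and 0 <= F_2 <= 1, so F_1 - F_2 <= 2e / D_1 <= 2e / a,
   and 2e / a <= 4 (1 - T) / T. *)

Lemma card_set_split (S : finType) (p q : pred S) :
  #|[set x | p x]| =
    (#|[set x | p x && q x]| + #|[set x | p x && ~~ q x]|)%N.
Proof.
rewrite -(cardsID [set x | q x]); congr (_ + _)%N.
  by apply: eq_card => x; rewrite !inE.
by apply: eq_card => x; rewrite !inE andbC.
Qed.

Lemma card_contingency (S : finType) (L1 L2 : S -> bool) :
  #|S| = (ct_a L1 L2 + ct_b L1 L2 + ct_c L1 L2 + ct_d L1 L2)%N.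
Proof.
rewrite -cardsT (card_set_split xpredT L1) (card_set_split _ L2).
by rewrite (card_set_split (fun x => true && ~~ L1 x) L2) addnA.
Qed.

Lemma cohen_kappa_disagreement (R : realType) (S : finType)
    (L1 L2 : S -> bool) (T : R) : (0 < #|S|)%N -> 0 < T ->
  T < cohen_kappa R L1 L2 ->
  T * ((ct_b L1 L2)%:R + (ct_c L1 L2)%:R) < 2 * (ct_a L1 L2)%:R * (1 - T).
Proof.
rewrite /cohen_kappa /observed_agreement /expected_agreement.
move=> S0 T0; have : 0 < #|S|%:R :> R by rewrite ltr0n.
rewrite (card_contingency L1 L2) !natrD.
have := ler0n R (ct_a L1 L2); have := ler0n R (ct_b L1 L2).
have := ler0n R (ct_c L1 L2); have := ler0n R (ct_d L1 L2).
move: (ct_a L1 L2)%:R (ct_b L1 L2)%:R (ct_c L1 L2)%:R (ct_d L1 L2)%:R.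
move=> a b c d d0 c0 b0 a0 n0.
set n := a + b + c + d in n0 *.
have nE : a + b + c + d = n by [].
clearbody n.
have dE : d = n - (a + b + c) by rewrite -nE addrAC subrr add0r.
(* [D] is n^2 (1 - p_e), so kappa becomes (D - (b + c) n) / D. *)
pose D := (a + b) * (b + d) + (a + c) * (c + d).
have nN0 : n != 0 by rewrite gt_eqF.
have D0 : 0 <= D by rewrite addr_ge0// mulr_ge0// addr_ge0.
have -> : 1 - ((a + b) * (a + c) / n ^+ 2 + (c + d) * (b + d) / n ^+ 2)
    = D / n ^+ 2 by rewrite /D dE; field.
have -> : (a + d) / n
    - ((a + b) * (a + c) / n ^+ 2 + (c + d) * (b + d) / n ^+ 2)
    = (D - (b + c) * n) / n ^+ 2 by rewrite /D dE; field.
rewrite invf_div mulrA divfK ?expf_neq0// => TK.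
(* If [D] were 0, kappa would be 0 by the convention x / 0 = 0, against 0 < T < kappa. *)
have Dgt0 : 0 < D.
  rewrite lt_neqAle D0 andbT; apply/eqP => DE.
  by move: TK; rewrite -DE invr0 mulr0 ltNge (ltW T0).
move: TK; rewrite ltr_pdivlMr// => TD.
have T1 : 0 < 1 - T.
  have dis0 : 0 <= (b + c) * n by rewrite mulr_ge0 ?(ltW n0) ?addr_ge0.
  rewrite -(pmulr_lgt0 _ Dgt0); lra.
have : (1 - T) * D <= (1 - T) * (n * (2 * a + b + c)).
  rewrite ler_pM2l// -subr_ge0.
  have -> : n * (2 * a + b + c) - D = 2 * ((a + b) * (a + c)).
    by rewrite -nE /D; ring.
  by rewrite mulr_ge0// mulr_ge0// addr_ge0.
(* Chaining (b + c) n < (1 - T) D with [DU] and cancelling [n] leaves b + c < (1 - T) (2a + b +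
   c). *)
move=> DU; rewrite -(ltr_pM2l n0); lra.
Qed.

(** Since 2a + b + c counts [L] and [y] separately, the term for [y] cancels when the denominators
    of two F-measures against [y] are subtracted. *)
Lemma f_measureE (R : realType) (S : finType) (L y : S -> bool) :
  f_measure R L y =
    2 * (ct_a L y)%:R / (#|[set x | L x]|%:R + #|[set x | y x]|%:R).
Proof.
rewrite /f_measure (card_set_split L y) (card_set_split y L) !natrD.
have -> : [set x | y x && L x] = [set x | L x && y x].
  by apply/setP => x; rewrite !inE andbC.
have -> : [set x | y x && ~~ L x] = [set x | ~~ L x && y x].
  by apply/setP => x; rewrite !inE andbC.
by congr (_ / _); rewrite /ct_a /ct_b /ct_c; ring.
Qed.

Lemma ct_aC (S : finType) (L1 L2 : S -> bool) : ct_a L1 L2 = ct_a L2 L1.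
Proof. by apply: eq_card => x; rewrite !inE andbC. Qed.

Lemma ct_cC (S : finType) (L1 L2 : S -> bool) : ct_c L1 L2 = ct_b L2 L1.
Proof. by apply: eq_card => x; rewrite !inE andbC. Qed.

Lemma f_measure_le1 (R : realType) (S : finType) (L y : S -> bool) :
  f_measure R L y <= 1.
Proof.
rewrite /f_measure; set u := _ + _ + _.
have ler_u : 2 * (ct_a L y)%:R <= u by rewrite /u -addrA lerDl addr_ge0.
have [u0|u0] := ltP 0 u; first by rewrite ler_pdivrMr// mul1r.
(* In the undefined case the quotient is 0 by convention. *)
suff -> : u = 0 by rewrite invr0 mulr0.
by apply/le_anti; rewrite u0 (le_trans _ ler_u)// mulr_ge0.
Qed.

Lemma f_measureB_le (R : realType) (S : finType) (L1 L2 y : S -> bool) :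
  (0 < ct_a L1 L2)%N ->
  f_measure R L1 y - f_measure R L2 y <=
    2 * ((ct_b L1 L2)%:R + (ct_c L1 L2)%:R) / (ct_a L1 L2)%:R.
Proof.
move=> a_gt0.
have F1 := f_measure_le1 R L2 y.
have F0 : 0 <= f_measure R L2 y by rewrite divr_ge0 ?addr_ge0 ?mulr_ge0.
move: F0 F1; rewrite !f_measureE.
(* A point of [L1] and [y] lies either in [L2] and [y], or in [L1] but not in [L2]. *)
have AB : (ct_a L1 y <= ct_a L2 y + ct_b L1 L2)%N.
  rewrite (leq_trans _ (leq_card_setU _ _))// subset_leq_card//.
  by apply/subsetP => x; rewrite !inE; case: (L1 x) (L2 x) (y x) => [] [] [].
move: AB; rewrite -(ler_nat R) natrD.
rewrite (card_set_split L1 L2) -/(ct_a L1 L2) -/(ct_b L1 L2).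
rewrite (card_set_split L2 L1) -/(ct_a L2 L1) -/(ct_b L2 L1) -(ct_cC L1 L2) (ct_aC L1 L2).
have : 0 < (ct_a L2 L1)%:R :> R by rewrite ltr0n ct_aC.
have := ler0n R #|[set x | y x]|; have := ler0n R (ct_b L1 L2).
have := ler0n R (ct_c L1 L2); rewrite !natrD.
move: (ct_a L2 L1)%:R (ct_b L1 L2)%:R (ct_c L1 L2)%:R => a b c.
move: #|[set x | y x]|%:R (ct_a L1 y)%:R (ct_a L2 y)%:R => Y A B.
move=> c0 b0 Y0 a0 AB; set F := _ / (a + c + Y) => F0 F1.
have BE : 2 * B = F * (a + c + Y) by rewrite divfK// gt_eqF//; lra.
have D0 : 0 < a + b + Y by lra.
(* By [AB] and [BE] the left side is at most 2b + F (c - b), hence at most 2b + c because 0 <= F <=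
   1. *)
have num : 2 * A - F * (a + b + Y) <= 2 * (b + c) by nra.
have -> : 2 * A / (a + b + Y) - F =
    (2 * A - F * (a + b + Y)) / (a + b + Y).
  by rewrite mulrBl mulfK// gt_eqF.
apply: (@le_trans _ _ (2 * (b + c) / (a + b + Y))).
  by rewrite ler_pM2r// invr_gt0.
rewrite ler_wpM2l//; first by lra.
rewrite lef_pV2 ?posrE//; lra.
Qed.

Theorem theorem3p2 (R : realType) (S : finType) (hS : (0 < #|S|)%N)
    (Mt Mt1 y : S -> bool) (T : R) (hT : 0 < T) :
  T < cohen_kappa R Mt Mt1 ->
  `|f_measure R Mt y - f_measure R Mt1 y| <= 4 * (1 - T) / T.
Proof.
move=> /(cohen_kappa_disagreement hS hT) K.
have e0 : 0 <= (ct_b Mt Mt1)%:R + (ct_c Mt Mt1)%:R :> R by rewrite addr_ge0.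
(* With a = 0, [K] would read T (b + c) < 0. *)
have a0 : (0 < ct_a Mt Mt1)%N.
  rewrite lt0n; apply/eqP => aE; move: K.
  by rewrite aE mulr0 mul0r ltNge mulr_ge0// ltW.
have B := f_measureB_le R y a0.
(* Exchanging the two models swaps [b] and [c], so the bound is unchanged. *)
have B' : f_measure R Mt1 y - f_measure R Mt y <=
    2 * ((ct_b Mt Mt1)%:R + (ct_c Mt Mt1)%:R) / (ct_a Mt Mt1)%:R.
  rewrite ct_cC [(ct_b Mt Mt1)%:R + _]addrC -[ct_b Mt Mt1]ct_cC ct_aC.
  by apply: f_measureB_le; rewrite ct_aC.
apply: (@le_trans _ _
    (2 * ((ct_b Mt Mt1)%:R + (ct_c Mt Mt1)%:R) / (ct_a Mt Mt1)%:R)).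
  by rewrite ler_norml B andbT lerNl opprB.
(* With denominators cleared, the goal is the weak form of twice [K]. *)
rewrite ler_pdivrMr ?ltr0n// mulrAC ler_pdivlMr//; lra.
Qed.
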